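(* Let $f:\mathbb{R}^n\to\mathbb{R}$ be convex and differentiable with Lipschitz continuous gradient, let $h:\mathbb{R}^m\to\mathbb{R}$ be a closed convex function, let $A\in\mathbb{R}^{m\times n}$, $\nu>0$ and $\lambda^{(k)}\in\mathbb{R}^m$. Define $\phi_1:\mathbb{R}^n\to\mathbb{R}$ by $$\phi_1(x):=f(x)+\min_{y\in\mathbb{R}^m}\left\{h(y)+\langle \lambda^{(k)},Ax-y\rangle+\frac{\nu}{2}\|Ax-y\|^2\right\}.$$ Then $\phi_1$ is differentiable and, for every $x\in\mathbb{R}^n$, $$\nabla\phi_1(x)=\nabla f(x)+A^T\left(\mathrm{prox}_{\nu h^*}(\nu Ax+\lambda^{(k)})\right).$$
   Context: $\langle\cdot,\cdot\rangle$ and $\|\cdot\|$ denote the Euclidean inner product and norm. A convex function $h$ is closed if $\{y : h(y)\le\alpha\}$ is a closed set for each $\alpha\in\mathbb{R}$. The conjugate function of $h$ is $h^*(v):=\sup_{u\in\mathbb{R}^m}\{\langle u,v\rangle-h(u)\}$ (with values in $\mathbb{R}\cup\{+\infty\}$). For a convex function $g$ (possibly taking the value $+\infty$), the proximal map is $\mathrm{prox}_g(y):=\mathrm{argmin}_x\left\{g(x)+\frac12\|y-x\|^2\right\}$; thus $\mathrm{prox}_{\nu h^*}$ is the proximal map of the function $\nu h^*$. The superscript in $\lambda^{(k)}$ is only an iteration index; $\lambda^{(k)}$ is a fixed vector. *)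

(* Defs.v *)
From mathcomp Require Import all_boot all_order all_algebra.
From mathcomp Require Import all_classical all_reals all_analysis.

Set Implicit Arguments.
Unset Strict Implicit.
Unset Printing Implicit Defensive.

Import Order.TTheory GRing.Theory Num.Theory.
Import numFieldNormedType.Exports.

Local Open Scope classical_set_scope.
Local Open Scope ring_scope.

(* The norm that the library puts on ['cV[R]_n] is the sup
   norm, hence the Euclidean norm below.  Closed sets and differentiability are
   the library's: in finite dimension they do not depend on the norm. *)

Definition dotp (R : realType) (n : nat) (u v : 'cV[R]_n) : R :=
  \sum_(i < n) u i 0 * v i 0.

Definition norm2 (R : realType) (n : nat) (u : 'cV[R]_n) : R :=
  Num.sqrt (dotp u u).

Definition grad (R : realType) (n : nat) (f : 'cV[R]_n -> R^o) (x : 'cV[R]_n) :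
    'cV[R]_n :=
  \col_(i < n) 'D_(delta_mx i 0) f x.

Definition lipschitz_grad (R : realType) (n : nat) (f : 'cV[R]_n -> R^o) : Prop :=
  exists L : R, forall x y : 'cV[R]_n,
    norm2 (grad f x - grad f y) <= L * norm2 (x - y).

Definition closed_function (R : realType) (m : nat) (h : 'cV[R]_m -> R^o) : Prop :=
  forall alpha : R, closed [set y | h y <= alpha].

Definition conjugate (R : realType) (m : nat) (h : 'cV[R]_m -> R^o)
    (v : 'cV[R]_m) : \bar R :=
  ereal_sup [set (dotp u v - h u)%:E | u in [set: 'cV[R]_m]].

Definition argmin (T : Type) (d : Order.disp_t) (P : porderType d) (F : T -> P) :
    set T :=
  [set p | forall x, (F p <= F x)%O].

Definition prox_objective (R : realType) (m : nat) (g : 'cV[R]_m -> \bar R)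
    (y x : 'cV[R]_m) : \bar R :=
  (g x + (2^-1 * norm2 (y - x) ^+ 2)%:E)%E.

(* [prox g y] is the element of the argmin only when that set is a singleton;
   it is 0 when the argmin is empty. *)
Definition prox (R : realType) (m : nat) (g : 'cV[R]_m -> \bar R)
    (y : 'cV[R]_m) : 'cV[R]_m :=
  xget 0 (argmin (prox_objective g y)).

Definition inner_objective (R : realType) (n m : nat) (h : 'cV[R]_m -> R^o)
    (A : 'M[R]_(m, n)) (nu : R) (lambda : 'cV[R]_m)
    (x : 'cV[R]_n) (y : 'cV[R]_m) : R :=
  h y + dotp lambda (A *m x - y) + nu / 2 * norm2 (A *m x - y) ^+ 2.

(* The minimum over y is written as an infimum in R: it has the intended meaning
   only when [argmin (inner_objective h A nu lambda x)] is nonempty. *)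
Definition phi1 (R : realType) (n m : nat) (f : 'cV[R]_n -> R^o)
    (h : 'cV[R]_m -> R^o) (A : 'M[R]_(m, n)) (nu : R) (lambda : 'cV[R]_m)
    (x : 'cV[R]_n) : R^o :=
  f x + inf (range (inner_objective h A nu lambda x)).

(* Main.v *)
(* Put [e z = min_y {h y + <lambda, z - y> + nu/2 |z - y|^2}], so that
   [phi1 = f + e o A].  The minimum is attained at some [y], since [h] is lower
   semicontinuous and, being convex, decreases at most linearly.  First-order
   optimality says that [p = lambda + nu (z - y)] is a subgradient of [h] at
   [y]; hence [y] is a subgradient of the conjugate at [p], and as
   [nu z + lambda - p = nu y] this makes [p] the unique minimizer of the
   strongly convex prox objective at [nu z + lambda].  Comparing the minimizers
   at [z] and [z'] gives
   [0 <= e z' - e z - <p, z' - z> <= nu/2 |z' - z|^2],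
   so [e] is differentiable at [z] with gradient [p]; the chain rule for [A] is
   absorbed into this estimate. *)

From HB Require Import structures.
Require Import Defs.
From mathcomp Require Import all_boot all_order all_algebra.
From mathcomp Require Import all_classical all_reals all_analysis.
From mathcomp Require Import finmap ring lra.

Set Implicit Arguments.
Unset Strict Implicit.
Unset Printing Implicit Defensive.

Import Order.TTheory GRing.Theory Num.Theory.
Import numFieldNormedType.Exports.

Local Open Scope classical_set_scope.
Local Open Scope ring_scope.

(** * Lower semicontinuity and compactness *)

(** Without a minimizer the open sets [F i < F y], [i] in [K], would cover [K]; in a finite subcover
    the index of least value lies in none of them. *)
Lemma compact_closed_sublevels_min (R : realType) (T : ptopologicalType)
    (K : set T) (F : T -> R) :
  K !=set0 -> compact K -> (forall a, closed [set y | F y <= a]) ->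
  exists2 p, K p & forall x, K x -> F p <= F x.
Proof.
move=> [x0 Kx0]; rewrite compact_cover => cK clF.
apply: contrapT => noMin.
have lowerP p : K p -> exists2 x, K x & F x < F p.
  move=> Kp; apply: contrapT => nx; apply: noMin; exists p => // x Kx.
  by rewrite leNgt; apply/negP => Fxp; apply: nx; exists x.
have [||D DK KD] := cK T K (fun i => [set y | F i < F y]).
- move=> i _; have -> : [set y | F i < F y] = ~` [set y | F y <= F i].
    by apply/seteqP; split => y /=; rewrite ltNge => /negP.
  exact/closed_openC/clF.
- by move=> p /lowerP[x Kx Fxp]; exists x.
have [i0 Di0 _] := KD _ Kx0.
case: (arg_minP (fun i : D => F (val i)) (erefl true : xpredT (FSetSub Di0))) => j _ jmin.
have Kj : K (val j) by move: (DK _ (fsvalP j)); rewrite in_setE.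
have [i Di /= Fij] := KD _ Kj.
by have := jmin (FSetSub Di) isT; rewrite /= leNgt Fij.
Qed.

Lemma closed_sublevelsD (R : realType) (T : topologicalType) (F G : T -> R) :
  (forall a, closed [set y | F y <= a]) -> continuous G ->
  forall a, closed [set y | F y + G y <= a].
Proof.
move=> clF cG a; rewrite -openC.
have -> : ~` [set y | F y + G y <= a] =
    \bigcup_(r in [set: R]) (~` [set y | F y <= r] `&` G @^-1` [set s | a - r < s]).
  apply/seteqP; split => y /=.
    move/negP; rewrite -ltNge => ay.
    (* The midpoint between [a - G y] and [F y]. *)
    exists ((F y + a - G y) / 2) => //; split=> /=; last by lra.
    by apply/negP; rewrite -ltNge; lra.
  by move=> [r _ [/= /negP]]; rewrite -ltNge => ? ?; apply/negP; rewrite -ltNge; lra.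
apply: bigcup_open => r _; apply: openI; first exact/closed_openC/clF.
by move/continuousP: cG; apply; exact: open_gt.
Qed.

Lemma ler_entry_mx_norm (R : realType) (m n : nat) (x : 'M[R]_(m, n)) i j :
  `|x i j| <= `|x|.
Proof.
by rewrite /Num.norm /= mx_normrE; exact: (le_bigmax _ (fun ij => `|x ij.1 ij.2|) (i, j)).
Qed.

Lemma mx_norm_ler (R : realType) (m n : nat) (x : 'M[R]_(m, n)) (r : R) :
  0 <= r -> (forall i j, `|x i j| <= r) -> `|x| <= r.
Proof.
by move=> r0 xr; rewrite /Num.norm /= mx_normrE; apply/bigmax_leP; split=> // -[i j].
Qed.

Lemma continuous_trmx (R : realType) (m n : nat) :
  continuous (fun v : 'M[R]_(m, n) => v^T).
Proof.
move=> v P [N Nv NP]; exists (fun i j => N j i) => [i j|w Nw].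
  by have := Nv j i; rewrite mxE.
by apply: NP => i j; rewrite mxE.
Qed.

(** A sup-norm ball is a product of segments; transposition reduces to row vectors. *)
Lemma compact_cV_closed_ball (R : realType) (m : nat) (z : 'cV[R]_m) (r : R) :
  0 <= r -> compact [set y : 'cV[R]_m | `|y - z| <= r].
Proof.
move=> r0.
have -> : [set y : 'cV[R]_m | `|y - z| <= r] =
    (fun v : 'rV[R]_m => v^T) @`
      [set v : 'rV[R]_m | forall i, `[z i 0 - r, z i 0 + r]%classic (v ord0 i)].
  apply/seteqP; split => [y /= yr|_ [v /= vr <-]].
    exists y^T; last exact: trmxK.
    move=> i; rewrite /= mxE in_itv /= -ler_distl.
    by have := le_trans (ler_entry_mx_norm (y - z) i 0) yr; rewrite !mxE.
  apply: mx_norm_ler => // i j; rewrite ord1 !mxE ler_distl.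
  by have := vr i; rewrite /= in_itv.
apply: continuous_compact; first exact/continuous_subspaceT/continuous_trmx.
apply: (@rV_compact _ _ (fun i => `[z i 0 - r, z i 0 + r]%classic)) => i.
exact: segment_compact.
Qed.

(** * Euclidean inner product and comparison with the sup norm *)

Lemma dotpC (R : realType) (n : nat) (u v : 'cV[R]_n) : dotp u v = dotp v u.
Proof. by apply: eq_bigr => i _; rewrite mulrC. Qed.

Lemma dotpDl (R : realType) (n : nat) (u v w : 'cV[R]_n) :
  dotp (u + v) w = dotp u w + dotp v w.
Proof. by rewrite -big_split; apply: eq_bigr => i _; rewrite !mxE mulrDl. Qed.

Lemma dotpZl (R : realType) (n : nat) (a : R) (u v : 'cV[R]_n) :
  dotp (a *: u) v = a * dotp u v.
Proof. by rewrite mulr_sumr; apply: eq_bigr => i _; rewrite !mxE mulrA. Qed.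

Lemma dotpNl (R : realType) (n : nat) (u v : 'cV[R]_n) :
  dotp (- u) v = - dotp u v.
Proof. by rewrite -scaleN1r dotpZl mulN1r. Qed.

Lemma dotpDr (R : realType) (n : nat) (u v w : 'cV[R]_n) :
  dotp u (v + w) = dotp u v + dotp u w.
Proof. by rewrite dotpC dotpDl !(dotpC u). Qed.

Lemma dotpZr (R : realType) (n : nat) (a : R) (u v : 'cV[R]_n) :
  dotp u (a *: v) = a * dotp u v.
Proof. by rewrite dotpC dotpZl dotpC. Qed.

Lemma dotpNr (R : realType) (n : nat) (u v : 'cV[R]_n) :
  dotp u (- v) = - dotp u v.
Proof. by rewrite dotpC dotpNl dotpC. Qed.

Lemma dotp0r (R : realType) (n : nat) (u : 'cV[R]_n) : dotp u 0 = 0.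
Proof. by rewrite -(scale0r 0) dotpZr mul0r. Qed.

Definition dotpE := (dotpDl, dotpDr, dotpNl, dotpNr, dotpZl, dotpZr).

Lemma dotp_trmx (R : realType) (m n : nat) (A : 'M[R]_(m, n)) u v :
  dotp u (A *m v) = dotp (A^T *m u) v.
Proof.
rewrite /dotp; under eq_bigr do rewrite mxE mulr_sumr.
under [RHS]eq_bigr do rewrite mxE mulr_suml.
rewrite exchange_big; apply: eq_bigr => i _; apply: eq_bigr => j _.
by rewrite mxE mulrCA mulrA.
Qed.

Lemma dotp_delta (R : realType) (n : nat) (u : 'cV[R]_n) i :
  dotp u (delta_mx i 0) = u i 0.
Proof.
rewrite /dotp (bigD1 i) //= mxE !eqxx mulr1 big1 ?addr0 // => j ji.
by rewrite mxE (negbTE ji) mulr0.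
Qed.

Lemma norm2_sqr (R : realType) (n : nat) (u : 'cV[R]_n) :
  norm2 u ^+ 2 = dotp u u.
Proof. by rewrite sqr_sqrtr //; apply: sumr_ge0 => i _; rewrite -expr2 sqr_ge0. Qed.

Lemma sqr_mx_norm_le_dotp (R : realType) (n : nat) (u : 'cV[R]_n) :
  `|u| ^+ 2 <= dotp u u.
Proof.
rewrite -norm2_sqr lerXn2r ?nnegrE ?sqrtr_ge0 //.
apply: mx_norm_ler => [|i j]; first exact: sqrtr_ge0.
rewrite -sqrtr_sqr ler_wsqrtr // ord1 /dotp (bigD1 i) //= expr2 lerDl.
by apply: sumr_ge0 => k _; rewrite -expr2 sqr_ge0.
Qed.

Lemma dotp_le_sqr_mx_norm (R : realType) (n : nat) (u : 'cV[R]_n) :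
  dotp u u <= n%:R * `|u| ^+ 2.
Proof.
rewrite /dotp mulr_natl -[X in _ *+ X]card_ord -sumr_const; apply: ler_sum => i _.
by rewrite -expr2 -real_normK ?num_real // lerXn2r ?nnegrE ?ler_entry_mx_norm.
Qed.

Lemma continuous_dotp (R : realType) (T : topologicalType) (n : nat)
    (f g : T -> 'cV[R]_n) :
  continuous f -> continuous g -> continuous (fun x => dotp (f x) (g x)).
Proof.
have entry (k : T -> 'cV[R]_n) i : continuous k -> continuous (fun x => k x i 0).
  by move=> ck x; exact: (continuous_comp (ck x) (@coord_continuous _ _ _ i 0 (k x))).
move=> cf cg; rewrite /dotp; apply: continuous_big => [|i _ x].
  exact: add_continuous.
by apply: cvgM; exact: entry.
Qed.

(** * Existence of a minimizer of the inner problem *)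

Lemma convex_function_segment (R : realType) (m : nat) (h : 'cV[R]_m -> R)
    (u v : 'cV[R]_m) (t : R) :
  convex_function [set: 'cV[R]_m] h -> 0 <= t <= 1 ->
  h (u + t *: (v - u)) <= h u + t * (h v - h u).
Proof.
move=> ch /andP[t0 t1].
have := ch (Itv01 t0 t1) v u (mem_set I) (mem_set I).
rewrite convRE /= /conv /= /unstable.onem.
have -> : t *: v + (1 - t) *: u = u + t *: (v - u).
  by rewrite scalerBl scalerBr scale1r addrCA addrA (addrC u).
by move=> /le_trans; apply; rewrite le_eqVlt; apply/orP; left; apply/eqP; ring.
Qed.

(* The inner objective of [phi1] with a free point [z] in place of [A x];
   it is convertible to [inner_objective] at [z := A *m x]. *)
Definition augmented (R : realType) (m : nat) (h : 'cV[R]_m -> R) (nu : R)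
    (lambda z y : 'cV[R]_m) : R :=
  h y + dotp lambda (z - y) + nu / 2 * norm2 (z - y) ^+ 2.

Lemma augmented_argmin (R : realType) (m : nat) (h : 'cV[R]_m -> R) (nu : R)
    (lambda z : 'cV[R]_m) :
  convex_function [set: 'cV[R]_m] h -> closed_function h -> 0 < nu ->
  argmin (augmented h nu lambda z) !=set0.
Proof.
move=> ch clh nu0.
have cz : continuous (fun y : 'cV[R]_m => z - y).
  by move=> y; apply: continuousB; [exact: cst_continuous|exact: cvg_id].
have cl : continuous (fun y : 'cV[R]_m => dotp lambda (z - y)).
  by apply: continuous_dotp => //; exact: cst_continuous.
have clk := closed_sublevelsD clh cl.
have cq : continuous (fun y : 'cV[R]_m => nu / 2 * dotp (z - y) (z - y)).
  by move=> y; exact: (cvgM (cvg_cst _) (continuous_dotp cz cz (x:=y))).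
have clF a : closed [set y | augmented h nu lambda z y <= a].
  rewrite /augmented; under eq_set do rewrite norm2_sqr.
  exact: (closed_sublevelsD clk cq).
pose k y := h y + dotp lambda (z - y).
have ballz r : 0 <= r -> [set y : 'cV[R]_m | `|y - z| <= r] z.
  by move=> r0 /=; rewrite subrr normr0.
have [b _ kb] := compact_closed_sublevels_min (ex_intro _ z (ballz _ ler01))
   (compact_cV_closed_ball ler01) clk.
have kz : k z = h z by rewrite /k subrr dotp0r addr0.
have kbz : k b <= k z by apply: kb; exact: ballz.
(* By convexity [k] decreases at most linearly away from [z], with slope
   [k z - k b]; outside radius [r] the quadratic term compensates for it. *)
pose r := 1 + 2 * (k z - k b) / nu.
have r1 : 1 <= r by rewrite lerDl divr_ge0 ?mulr_ge0 ?subr_ge0 // ltW.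
have r0 : 0 <= r by apply: le_trans r1.
have [p _ Fp] := compact_closed_sublevels_min (ex_intro _ z (ballz _ r0))
   (compact_cV_closed_ball r0) clF.
exists p => y; have [yr|ry] := leP `|y - z| r; first exact: Fp.
apply: (le_trans (Fp _ (ballz _ r0))).
rewrite /augmented !norm2_sqr subrr !dotp0r mulr0 !addr0 -kz -/(k y).
set s := `|y - z| in ry; have s1 : 1 < s by lra.
have s0 : s != 0 by lra.
have s01 : 0 <= s^-1 <= 1 by apply/andP; split; rewrite ?invr_ge0 ?invf_le1; lra.
(* The point at distance 1 from [z] towards [y] is in the unit ball, where [b] is minimal; convexity
   bounds [k] there. *)
have ks : k b <= k z + s^-1 * (k y - k z).
  apply: le_trans (kb (z + s^-1 *: (y - z)) _) _.
    by rewrite /= addrAC subrr add0r normrZ normfV normr_id mulVf.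
  have := convex_function_segment z y ch s01.
  rewrite /k opprD addrA subrr !dotpE dotp0r; lra.
have ky : s * (k b - k z) <= k y - k z.
  by rewrite mulrC -ler_pdivlMr; lra.
have sD : nu / 2 * s ^+ 2 <= nu / 2 * dotp (z - y) (z - y).
  by rewrite ler_wpM2l ?divr_ge0 ?(ltW nu0) // /s distrC sqr_mx_norm_le_dotp.
have kbE : k z - k b = nu / 2 * (r - 1) by rewrite /r; field; lra.
have : 0 <= nu / 2 * s * (s - r + 1) by rewrite !mulr_ge0 ?divr_ge0; lra.
have : s * (k b - k z) = - (nu / 2 * s * (r - 1)) by rewrite -opprB kbE; ring.
lra.
Qed.

(** * Optimality, conjugacy and the proximal point *)

Section MoreauEnvelope.
Variables (R : realType) (m : nat) (h : 'cV[R]_m -> R) (nu : R).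
Variables (lambda z y : 'cV[R]_m).
Hypotheses (h_convex : convex_function [set: 'cV[R]_m] h) (nu_gt0 : 0 < nu).
Hypothesis y_argmin : argmin (augmented h nu lambda z) y.

Let p := lambda + nu *: (z - y).

Lemma argmin_subgradient u : h y + dotp p (u - y) <= h u.
Proof.
rewrite leNgt; apply/negP => hu.
(* Moving from [y] to [y + t (u - y)] changes the objective by at most
   [t (c t - d)], which is negative for the [t] below. *)
pose d := h y + dotp p (u - y) - h u; have d0 : 0 < d by rewrite subr_gt0.
pose c := nu / 2 * dotp (u - y) (u - y).
have c0 : 0 <= c by rewrite mulr_ge0 ?divr_ge0 ?(ltW nu_gt0) // -norm2_sqr sqr_ge0.
pose t := d / (d + c + 1).
have dc0 : 0 < d + c + 1 by lra.
have t0 : 0 < t by rewrite divr_gt0.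
have tE : t * (d + c + 1) = d by rewrite divfK // gt_eqF.
have t01 : 0 <= t <= 1 by rewrite ltW //= ler_pdivrMr //; lra.
have := convex_function_segment y u h_convex t01.
have := y_argmin (y + t *: (u - y)).
rewrite /augmented !norm2_sqr => Fy hc.
have : 0 <= t * (c * t - d).
  have -> : t * (c * t - d) = t * (h u - h y) - t * dotp p (u - y) + t ^+ 2 * c.
    by rewrite /d; ring.
  move: Fy hc; rewrite /c /p !dotpE (dotpC u y) (dotpC y z) (dotpC u z).
  nra.
(* By [tE], [c * t - d = - t * (d + 1) < 0]. *)
rewrite pmulr_rge0 //; nra.
Qed.

(** The equality case of Fenchel-Young, as [p] is a subgradient at [y]. *)
Lemma conjugate_argmin : conjugate h p = (dotp p y - h y)%:E.
Proof.
apply/eqP; rewrite eq_le; apply/andP; split.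
  apply: ge_ereal_sup => _ [u _ <-]; rewrite lee_fin dotpC.
  have := argmin_subgradient u; rewrite !dotpE; lra.
by apply: ereal_sup_ubound; exists y => //; rewrite dotpC.
Qed.

Let nu_hconj v := (nu%:E * conjugate h v)%E.

Lemma conjugate_ge v : ((dotp v y - h y)%:E <= conjugate h v)%E.
Proof. by apply: ereal_sup_ubound; exists y => //; rewrite dotpC. Qed.

(* With [w = nu z + lambda], [w - p = nu y] is [nu] times a subgradient of
   the conjugate at [p], whence the quadratic growth of the prox objective. *)
Lemma prox_objective_growth v :
  (prox_objective nu_hconj (nu *: z + lambda) p + (2^-1 * dotp (v - p) (v - p))%:E
   <= prox_objective nu_hconj (nu *: z + lambda) v)%E.
Proof.
rewrite /prox_objective /nu_hconj conjugate_argmin.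
(* Once the conjugate at [v] is replaced by its Fenchel-Young minorant at [y], expanding the square
   around [p] gives equality. *)
apply: (@le_trans _ _ ((nu * (dotp v y - h y))%:E +
    (2^-1 * norm2 (nu *: z + lambda - v) ^+ 2)%:E)%E).
  rewrite -!EFinM -!EFinD lee_fin !norm2_sqr /p !dotpE.
  rewrite (dotpC v lambda) (dotpC v z) (dotpC v y) (dotpC y lambda)
   (dotpC z lambda) (dotpC y z).
  nra.
rewrite leeD2r // EFinM lee_pmul2l ?lte_fin //; exact: conjugate_ge.
Qed.

Lemma argmin_prox_objective :
  argmin (prox_objective nu_hconj (nu *: z + lambda)) = [set p].
Proof.
(* Finiteness at [p] permits cancelling this value in the extended reals. *)
have fin : prox_objective nu_hconj (nu *: z + lambda) p \is a fin_num.
  by rewrite /prox_objective /nu_hconj conjugate_argmin -EFinM -EFinD.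
apply/seteqP; split => [v vmin|_ -> v] /=.
  have := le_trans (prox_objective_growth v) (vmin p).
  rewrite -(fineK fin) -EFinD lee_fin gerDl pmulr_rle0 ?invr_gt0 // => vp.
  have : `|v - p| ^+ 2 <= 0 by apply: le_trans (sqr_mx_norm_le_dotp _) vp.
  by rewrite exprn_even_le0 //= normr_eq0 subr_eq0 => /eqP.
apply: le_trans (prox_objective_growth v); apply: leeDl; rewrite lee_fin.
by rewrite mulr_ge0 // -norm2_sqr sqr_ge0.
Qed.

Lemma prox_augmented_argmin : prox nu_hconj (nu *: z + lambda) = p.
Proof.
(* The argmin is a singleton, so [xget] does not fall back to 0. *)
by rewrite /prox argmin_prox_objective; case: xgetP => [_ _ //|/(_ p) []].
Qed.

(** Upper bound: [y] competes at [z']. Lower bound: the subgradient inequality at [y'] leaves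
    [nu / 2] times the squared norm of [(z' - y') - (z - y)]. *)
Lemma augmented_argmin_expansion z' y' :
  argmin (augmented h nu lambda z') y' ->
  `|augmented h nu lambda z' y' - augmented h nu lambda z y - dotp p (z' - z)|
    <= nu / 2 * dotp (z' - z) (z' - z).
Proof.
move=> y'_argmin; rewrite ger0_norm.
  have := y'_argmin y; rewrite /augmented !norm2_sqr.
  rewrite /p !dotpE (dotpC y z) (dotpC y z') (dotpC z z').
  lra.
have := argmin_subgradient y'.
have : 0 <= nu / 2 * dotp (z' - y' - (z - y)) (z' - y' - (z - y)).
  by rewrite mulr_ge0 ?divr_ge0 ?(ltW nu_gt0) // -norm2_sqr sqr_ge0.
rewrite /augmented !norm2_sqr /p !dotpE.
rewrite (dotpC y z) (dotpC y z') (dotpC z z') (dotpC y' z) (dotpC y' z') (dotpC y' y).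
lra.
Qed.

End MoreauEnvelope.

(** * Differentiability of the envelope and the gradient formula *)

Lemma inf_range_argmin (R : realType) (T : Type) (F : T -> R) (y : T) :
  argmin F y -> inf (range F) = F y.
Proof.
move=> Fy; have lbF : lbound (range F) (F y) by move=> _ [x _ <-]; exact: Fy.
apply/eqP; rewrite eq_le; apply/andP; split.
  by apply: ge_inf; [exists (F y)|exists y].
by apply: lb_le_inf => //; exists (F y), y.
Qed.

Lemma is_diff_quadratic_error (R : realType) (V W : normedModType R) (f : V -> W)
    (df : {linear V -> W}) (x : V) (C : R) :
  continuous df ->
  (forall v, `|f (v + x) - f x - df v| <= C * `|v| ^+ 2) ->
  is_diff x f df.
Proof.
move=> cdf fC.
have fE : f \o shift x = cst (f x) + df +o_ 0 id.
  apply/eqaddoP => e e0; near=> v.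
  rewrite /= opprD addrA; apply: le_trans (fC v) _.
  (* Adding 1 keeps the divisor of [e] positive for every [C]. *)
  have C0 : 0 < `|C| + 1 by rewrite ltr_wpDl.
  rewrite expr2 mulrA ler_wpM2r //.
  have : `|v| <= e / (`|C| + 1).
    by near: v; apply: cvgr0_norm_le; [exact: cvg_id|rewrite divr_gt0].
  rewrite ler_pdivlMr // => ve; apply: le_trans ve.
  by rewrite mulrC ler_wpM2l // (le_trans (ler_norm C)) ?lerDl.
have dfE := diff_unique cdf fE.
by apply: DiffDef => //; apply/diff_locallyP; rewrite dfE.
Unshelve. all: by end_near. Qed.

Lemma dotp_is_linear (R : realType) (n : nat) (q : 'cV[R]_n) :
  linear (dotp q : 'cV[R]_n -> R^o).
Proof. by move=> a u v; rewrite dotpDr dotpZr. Qed.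

(** Lets [dotp q] serve as the linear map [df] in [is_diff_quadratic_error]. *)
HB.instance Definition _ (R : realType) (n : nat) (q : 'cV[R]_n) :=
  GRing.isLinear.Build R 'cV[R]_n R^o _ (dotp q : 'cV[R]_n -> R^o) (dotp_is_linear q).

Lemma mx_norm_mulmx (R : realType) (m n : nat) (A : 'M[R]_(m, n)) (v : 'cV[R]_n) :
  `|A *m v| <= n%:R * `|A| * `|v|.
Proof.
apply: mx_norm_ler => [|i j]; first by rewrite !mulr_ge0.
rewrite mxE; apply: le_trans (ler_norm_sum _ _ _) _.
rewrite -mulrA mulr_natl -[X in _ *+ X]card_ord -sumr_const; apply: ler_sum => k _.
by rewrite normrM ler_pM ?ler_entry_mx_norm.
Qed.

Lemma is_diff_envelope (R : realType) (n m : nat) (h : 'cV[R]_m -> R)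
    (A : 'M[R]_(m, n)) (nu : R) (lambda : 'cV[R]_m) (x : 'cV[R]_n) :
  convex_function [set: 'cV[R]_m] h -> closed_function h -> 0 < nu ->
  is_diff x (fun x => inf (range (augmented h nu lambda (A *m x))) : R^o)
    (dotp (A^T *m prox (fun v => nu%:E * conjugate h v)%E
       (nu *: (A *m x) + lambda))).
Proof.
move=> ch clh nu0.
(* In the constant, [m] compares the squared Euclidean and sup norms, and [n%:R * |A|] bounds [A] as
   an operator for the sup norm. *)
apply: (@is_diff_quadratic_error _ _ _ _ _ _ (nu / 2 * (m%:R * (n%:R * `|A|) ^+ 2))).
  by apply: continuous_dotp => ?; [exact: cst_continuous|exact: cvg_id].
move=> v /=.
have [y yP] := augmented_argmin lambda (A *m x) ch clh nu0.
have [y' y'P] := augmented_argmin lambda (A *m (v + x)) ch clh nu0.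
rewrite (inf_range_argmin yP) (inf_range_argmin y'P).
rewrite (prox_augmented_argmin ch nu0 yP) -dotp_trmx.
have := augmented_argmin_expansion ch nu0 yP y'P.
rewrite -mulmxBr addrK => /le_trans; apply.
rewrite -[leRHS]mulrA ler_wpM2l ?divr_ge0 ?(ltW nu0) //.
apply: le_trans (dotp_le_sqr_mx_norm _) _.
rewrite -[leRHS]mulrA ler_wpM2l // -exprMn lerXn2r ?nnegrE ?mulr_ge0 //.
exact: mx_norm_mulmx.
Qed.

Theorem theorem1 (R : realType) (n m : nat) (f : 'cV[R]_n -> R^o)
    (h : 'cV[R]_m -> R^o) (A : 'M[R]_(m, n)) (nu : R) (lambda : 'cV[R]_m)
    (f_convex : convex_function [set: 'cV[R]_n] f)
    (f_diff : forall x : 'cV[R]_n, differentiable f x)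
    (f_lip : lipschitz_grad f)
    (h_convex : convex_function [set: 'cV[R]_m] h)
    (h_closed : closed_function h)
    (nu_gt0 : 0 < nu) :
  let nu_hconj := fun v : 'cV[R]_m => (nu%:E * conjugate h v)%E in
  (* the minimum defining phi1 is attained *)
  (forall x : 'cV[R]_n, argmin (inner_objective h A nu lambda x) !=set0) /\
  (* the proximal point exists and is unique *)
  (forall y : 'cV[R]_m,
    argmin (prox_objective nu_hconj y) = [set prox nu_hconj y]) /\
  (forall x : 'cV[R]_n, differentiable (phi1 f h A nu lambda) x) /\
  (forall x : 'cV[R]_n,
    grad (phi1 f h A nu lambda) x =
      grad f x + A^T *m prox nu_hconj (nu *: (A *m x) + lambda)).
Proof.
move=> nu_hconj.
have phi1_diff x := is_diffD (differentiableP (f_diff x))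
  (is_diff_envelope A lambda x h_convex h_closed nu_gt0).
split; first by move=> x; exact: augmented_argmin.
split.
  (* As [nu] is invertible, every [w] has the form [nu z + lambda], so the argmin computed above
     covers all points. *)
  move=> w; have wE : w = nu *: (nu^-1 *: (w - lambda)) + lambda.
    by rewrite scalerA mulfV ?gt_eqF // scale1r subrK.
  have [y yP] := augmented_argmin lambda (nu^-1 *: (w - lambda)) h_convex h_closed nu_gt0.
  rewrite wE (argmin_prox_objective h_convex nu_gt0 yP).
  by rewrite (prox_augmented_argmin h_convex nu_gt0 yP).
have phi1_differentiable x : differentiable (phi1 f h A nu lambda) x.
  by have [] := phi1_diff x.
split=> // x; apply/colP => i; rewrite [LHS]mxE [RHS]mxE [X in X + _]mxE.
(* The differential at the [i]-th basis vector is the [i]-th entry of the gradient. *)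
rewrite (deriveE _ (phi1_differentiable x)) (deriveE _ (f_diff x)).
have [_ ->] := phi1_diff x.
by rewrite -dotp_delta.
Qed.
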